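(* Let $r\ge 2$ be an integer and $N=\binom{r+1}{2}$. Let $K_{r+1}$ be the complete graph on $r+1$ vertices and $F_{K_{r+1}}$ its Kirchhoff polynomial, a polynomial in $N$ variables. Then $$\det H_{F_{K_{r+1}}}=(-1)^{N-1}c_r\,(F_{K_{r+1}})^{N-r-1},$$ where $c_r=2^{N-r}(r-1)$.
   Context: For a finite connected graph $\Gamma=(V,E)$ with edges labelled $1,\dots,n$, the Kirchhoff polynomial is $F_\Gamma(x_1,\dots,x_n)=\sum_{T}\prod_{i\in T}x_i$, the sum over all spanning trees $T$ of $\Gamma$ (identified with their edge sets). $H_F=\left(\frac{\partial^2F}{\partial x_i\partial x_j}\right)_{i,j}$ is the Hessian matrix of $F$. *)

(* Defs.v *)
From HB Require Import structures.
From mathcomp Require Import all_boot all_order all_algebra.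
From mathcomp Require Import mpoly.

Set Implicit Arguments.
Unset Strict Implicit.
Unset Printing Implicit Defensive.

Import GRing.Theory.
Local Open Scope ring_scope.

(* mpoly shadows the name symmetric. *)
Record sgraph := SGraph {
  vertex :> finType;
  adj : rel vertex;
  adj_sym : ssrbool.symmetric adj;
  adj_irr : irreflexive adj }.

Definition edges (G : sgraph) : {set {set G}} :=
  [set [set p.1; p.2] | p : G * G & adj p.1 p.2].

(* A labelling of the n edges of G by 'I_n (0-based: the label i of 'I_n
   stands for i + 1). *)
Record edge_labelling (G : sgraph) (n : nat) := EdgeLabelling {
  label_edge :> 'I_n -> {set G};
  label_edge_inj : injective label_edge;
  label_edge_im : [set label_edge i | i : 'I_n] = edges G }.

Section SpanningTrees.
Variable G : sgraph.
Implicit Type T : {set {set G}}.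

Definition edge_rel T : rel G := fun x y => [set x; y] \in T.

Definition spanning_connected T : bool :=
  [forall x, forall y, connect (edge_rel T) x y].

(* A cycle visits at least three pairwise distinct vertices, hence at most
   #|G| of them: the bound on k only serves to make the predicate boolean,
   see acyclicP. *)
Definition acyclic T : bool :=
  [forall k : 'I_#|G|.+1, forall c : k.-tuple G,
     (2 < k)%N ==> ~~ ucycleb (edge_rel T) c].

Lemma acyclicP T :
  reflect (forall c : seq G, (2 < size c)%N -> ~ ucycle (edge_rel T) c)
          (acyclic T).
Proof.
apply: (iffP forallP) => [acT c c_gt2 cyc | acT k].
  have c_uniq : uniq c by case/andP: cyc.
  have c_le : (size c < #|G|.+1)%N.
    by rewrite ltnS -(card_uniqP c_uniq) max_card.
  have /forallP/(_ (in_tuple c)) := acT (Ordinal c_le).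
  by rewrite /= c_gt2 /= => /negP; apply.
apply/forallP => c; apply/implyP => k_gt2; apply/negP.
by apply: acT; rewrite size_tuple.
Qed.

Definition spanning_tree T : bool :=
  [&& T \subset edges G, spanning_connected T & acyclic T].

End SpanningTrees.

Definition kirchhoff (R : comNzRingType) (G : sgraph) (n : nat)
    (lab : edge_labelling G n) : {mpoly R[n]} :=
  \sum_(T : {set 'I_n} | spanning_tree [set lab i | i in T])
    \prod_(i in T) 'X_i.

Definition hessian (R : comNzRingType) (n : nat) (F : {mpoly R[n]}) :
    'M[{mpoly R[n]}]_n :=
  \matrix_(i, j) mderiv i (mderiv j F).

Section Complete.
Variable m : nat.

Definition complete_adj : rel 'I_m := fun x y => x != y.

Fact complete_adj_sym : ssrbool.symmetric complete_adj.
Proof. by move=> x y; rewrite /complete_adj eq_sym. Qed.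

Fact complete_adj_irr : irreflexive complete_adj.
Proof. by move=> x; rewrite /complete_adj eqxx. Qed.

Definition complete_graph : sgraph := SGraph complete_adj_sym complete_adj_irr.

Lemma edges_completeE :
  edges complete_graph = [set A : {set 'I_m} | #|A| == 2].
Proof.
apply/setP => A; rewrite inE; apply/imsetP/cards2P.
  by case=> -[x y]; rewrite inE => nxy ->; exists x, y.
by case=> x [y [nxy ->]]; exists (x, y); rewrite ?inE.
Qed.

Lemma card_edges_complete : #|edges complete_graph| = 'C(m, 2).
Proof. by rewrite edges_completeE card_draws card_ord. Qed.

(* Labellings of K_m by 'C(m, 2) labels exist. *)
Lemma complete_labelling : inhabited (edge_labelling complete_graph 'C(m, 2)).
Proof.
rewrite -card_edges_complete; constructor.
apply: (@EdgeLabelling complete_graph _ (@enum_val _ (mem (edges complete_graph)))).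
  exact: enum_val_inj.
apply/setP => A; apply/imsetP/idP => [[i _ ->] | A_in]; first exact: enum_valP.
by exists (enum_rank_in A_in A); rewrite // enum_rankK_in.
Qed.

End Complete.

(* Main.v *)
Require Import Defs.
From mathcomp Require Import all_boot all_order all_algebra all_fingroup.
From mathcomp Require Import mpoly ring zify.

(** Why the theorem holds.

    Put the root at vertex 0, orient the edges, and let B be the incidence
    matrix, one row b_i per edge and one column per vertex other than the
    root.  By the matrix-tree theorem (kirchhoff_det), F is the determinant of
    the weighted Laplacian M = B^T diag(x) B, whose derivative along x_i is the
    rank one matrix b_i^T b_i.

    Let a = B adj(M) B^T, let u be the diagonal of a, and let Q be the matrix
    of the squares a_ij^2.  Differentiating det M and adj M gives
    F H = u u^T - Q (hessian_det_laplacian).  This rank one perturbation of Q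
    is easy to control because Euler-type relations hold with the vector of
    variables: Q x = F u and u^T x = r F.  Hence
    det (Q - u u^T) = (1 - r) det Q (det_rank1_update), which accounts for the
    factor r - 1.  Everything up to here is valid for any graph.

    Completeness of the graph enters in the value of det Q.  The N matrices
    b_i^T b_i then form a basis of the symmetric r x r matrices, and Q is the
    Gram matrix of the form (S, T) |-> tr (S adj(M) T adj(M)) in this basis.
    So det Q is the determinant of the symmetric square of adj(M), namely
    det(adj M)^(r+1) (det_sym2), times a constant that is 2^(N - r)
    (det_gram_squares).  As det(adj M) = F^(r-1), we obtain
    F^N det H = (-1)^N (1 - r) 2^(N-r) F^((r-1)(r+1)), and the theorem follows
    by cancelling F^N, since (r-1)(r+1) = N + (N - r - 1).

    The matrix-tree theorem is proved by expanding det M over the maps f that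
    choose an edge f k for every non-root vertex k (det_incident): such a map
    contributes 1 if following the chosen edges leads every vertex to the root
    and 0 otherwise, and the maps that contribute correspond bijectively to the
    spanning trees, oriented towards the root. *)

Set Implicit Arguments.
Unset Strict Implicit.
Unset Printing Implicit Defensive.

Import GRing.Theory.
Local Open Scope ring_scope.

(** * Determinants *)

Section Determinants.
Variable R : comNzRingType.

(** A permutation that contributes to the determinant never raises the weight
    [w]; as it preserves the total weight, it preserves each weight, and the
    hypothesis then forces it to be the identity.  No ordering of the indices
    compatible with [w] has to be chosen. *)
Lemma det_graded_triangular n (A : 'M[R]_n) (w : 'I_n -> nat) :
    (forall i j, A i j != 0 -> (i == j) || (w j < w i)%N) ->
  \det A = \prod_i A i i.
Proof.
move=> trA; rewrite /determinant (bigD1 (1%g : {perm 'I_n})) //=.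
rewrite odd_perm1 expr0 mul1r.
rewrite [X in _ + X]big1 ?addr0 => [|s s_neq1].
  by apply: eq_bigr => i _; rewrite perm1.
case: (boolP [exists i, A i (s i) == 0]) => [/existsP[i /eqP A0]|].
  by rewrite (bigD1 i) //= A0 mul0r mulr0.
rewrite negb_exists => /forallP trs; exfalso.
have le_w i : (w (s i) <= w i)%N.
  by case/orP: (trA _ _ (trs i)) => [/eqP <- //|/ltnW].
have [i si] : exists i, s i != i.
  apply/existsP; apply: contraR s_neq1; rewrite negb_exists => /forallP sE.
  by apply/eqP/permP => i; rewrite perm1; apply/eqP/negPn.
have lt_i : (w (s i) < w i)%N.
  by case/orP: (trA _ _ (trs i)) => // /eqP si'; rewrite -si' eqxx in si.
have : (\sum_j w (s j) < \sum_j w j)%N.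
  rewrite (bigD1 i) //= [X in (_ < X)%N](bigD1 i) //= -addSn.
  by apply: leq_add => //; apply: leq_sum => j _.
by rewrite [X in (_ < X)%N](reindex_inj (@perm_inj _ s)) ltnn.
Qed.

(** Over a commutative ring a nonzero kernel vector is not enough, but one with
    an entry equal to 1 is: multiply [A *m v = 0] by the adjugate. *)
Lemma det_kernel n (A : 'M[R]_n) (v : 'cV[R]_n) (k : 'I_n) :
  A *m v = 0 -> v k 0 = 1 -> \det A = 0.
Proof.
move=> Av vk.
have : (\adj A *m A *m v) k 0 = 0 by rewrite -mulmxA Av mulmx0 mxE.
by rewrite mul_adj_mx mul_scalar_mx mxE vk mulr1.
Qed.

(** The matrix determinant lemma without dividing by [c] or [\det Q]: the
    vector [x] stands for [c] times the inverse of [Q] applied to [u].  Both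
    sides are [c] times the determinant of [Q] bordered by 1, [u^T] and [u],
    reduced once by row operations and once by column operations. *)
Lemma det_rank1_update n (Q : 'M[R]_n) (u x : 'cV[R]_n) (c s : R) :
    Q *m x = c *: u -> u^T *m x = s%:M ->
  c * \det (Q - u *m u^T) = (c - s) * \det Q.
Proof.
move=> Qx ux.
pose B := block_mx (1%:M : 'M_1) u^T u Q.
have E1 : block_mx (1%:M : 'M_1) 0 (- u) 1%:M *m B
          = block_mx 1%:M u^T 0 (Q - u *m u^T).
  rewrite mulmx_block !mul1mx !mul0mx !addr0 mulmx1 addNr mulNmx.
  by rewrite [- _ + _]addrC.
have E2 : B *m block_mx (c%:M : 'M_1) 0 (- x) 1%:M
          = block_mx (c - s)%:M u^T 0 Q.
  rewrite mulmx_block !mul1mx !mulmx0 !mulmx1 !add0r !mulmxN Qx ux.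
  by rewrite mul_mx_scalar subrr raddfB.
have := congr1 determinant E1; have := congr1 determinant E2.
rewrite !det_mulmx !det_ublock !det_lblock !det1 !det_scalar1 !mulr1 !mul1r.
by move=> <- <-; rewrite mulrC.
Qed.

End Determinants.

Lemma det_adjugate (R : idomainType) n (A : 'M[R]_n.+1) :
  \det A != 0 -> \det (\adj A) = \det A ^+ n.
Proof.
move=> A0; apply: (mulfI A0).
by rewrite -det_mulmx mul_mx_adj det_scalar exprS.
Qed.

(** * Derivations applied to determinants and adjugates *)

Section Derivation.
Variables (A : comNzRingType) (d : {additive A -> A}).
Hypothesis dM : forall x y, d (x * y) = d x * y + x * d y.

Lemma derivation1 : d 1 = 0.
Proof. by apply: (addrI (d 1)); rewrite -{3}[1]mulr1 dM mulr1 mul1r addr0. Qed.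

Lemma derivation_sign (b : bool) x : d ((-1) ^+ b * x) = (-1) ^+ b * d x.
Proof. by rewrite !mulr_sign; case: b => //; rewrite raddfN. Qed.

Lemma derivation_prod (I : eqType) (s : seq I) (F : I -> A) : uniq s ->
  d (\prod_(i <- s) F i) =
  \sum_(i <- s) \prod_(j <- s) (if j == i then d (F j) else F j).
Proof.
elim: s => [|i s IHs] /=; first by rewrite !big_nil derivation1.
case/andP=> i_s s_uniq; rewrite !big_cons dM IHs // eqxx; congr (_ * _ + _).
  rewrite !big_seq; apply: eq_bigr => j j_s.
  by case: eqP => // ji; rewrite -ji j_s in i_s.
rewrite mulr_sumr !big_seq; apply: eq_bigr => j j_s; rewrite big_cons.
by case: eqP => // ij; rewrite ij j_s in i_s.
Qed.

(** Jacobi's formula: the product rule differentiates one row at a time, and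
    each term is expanded along the differentiated row. *)
Lemma derivation_det n (M : 'M[A]_n) :
  d (\det M) = \tr (map_mx d M *m \adj M).
Proof.
pose Mk k := \matrix_(i, j) (if i == k then d (M i j) else M i j).
transitivity (\sum_k \det (Mk k)).
  rewrite /determinant raddf_sum exchange_big /=; apply: eq_bigr => s _.
  rewrite derivation_sign derivation_prod ?index_enum_uniq // mulr_sumr.
  apply: eq_bigr => k _; congr (_ * _); apply: eq_bigr => i _.
  by rewrite mxE.
rewrite /mxtrace; apply: eq_bigr => k _; rewrite (expand_det_row _ k) mxE.
apply: eq_bigr => l _; rewrite !mxE eqxx; congr (_ * _).
rewrite /cofactor; congr (_ * \det _); apply/matrixP => i j.
by rewrite !mxE eq_sym (negPf (neq_lift _ _)).
Qed.

Lemma derivation_mulmx m n p (M : 'M[A]_(m, n)) (P : 'M[A]_(n, p)) :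
  map_mx d (M *m P) = map_mx d M *m P + M *m map_mx d P.
Proof.
apply/matrixP => i j; rewrite !mxE raddf_sum -big_split; apply: eq_bigr => k _.
by rewrite dM !mxE.
Qed.

(** Obtained by differentiating [M *m \adj M = (\det M)%:M]. *)
Lemma derivation_adj n (M : 'M[A]_n) :
  \det M *: map_mx d (\adj M) =
    d (\det M) *: \adj M - \adj M *m map_mx d M *m \adj M.
Proof.
have /(congr1 (map_mx d)) := mul_mx_adj M.
rewrite derivation_mulmx => /(congr1 (mulmx (\adj M))).
rewrite mulmxDr !mulmxA mul_adj_mx mul_scalar_mx => E.
apply/eqP; rewrite eq_sym subr_eq addrC E -mul_mx_scalar; apply/eqP.
by congr (_ *m _); apply/matrixP => i j; rewrite !mxE raddfMn.
Qed.

End Derivation.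

(** * Hessian of the determinant of a weighted Laplacian *)

Section Laplacian.
Variables (A : comNzRingType) (n r : nat).
Variables (B : 'M[A]_(n, r)) (x : 'I_n -> A).

Definition laplacian : 'M[A]_r := B^T *m diag_mx (\row_i x i) *m B.

(** The Gram matrix of the rows of [B] for the bilinear form given by
    [\adj laplacian]. *)
Definition adj_gram : 'M[A]_n := B *m \adj laplacian *m B^T.

Lemma laplacianE k l : laplacian k l = \sum_i x i * (B i k * B i l).
Proof.
rewrite mxE; apply: eq_bigr => i _.
by rewrite mul_mx_diag !mxE [B i k * _]mulrC mulrA.
Qed.

Lemma laplacian_tr : laplacian^T = laplacian.
Proof. by rewrite /laplacian !trmx_mul trmxK tr_diag_mx mulmxA. Qed.

Lemma adj_gram_sym i j : adj_gram i j = adj_gram j i.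
Proof.
suff E : adj_gram^T = adj_gram by rewrite -[in LHS]E mxE.
by rewrite /adj_gram !trmx_mul trmxK trmx_adj laplacian_tr mulmxA.
Qed.

(** Two relations of Euler type, which provide the hypotheses of
    [det_rank1_update].  They hold because [B^T *m diag_mx x *m B], which
    appears between two adjugates here and next to one in the lemma that
    follows, is the Laplacian itself. *)
Lemma adj_gram_squares_weights :
  (\matrix_(i, j) adj_gram i j ^+ 2) *m (\col_j x j) =
  \det laplacian *: \col_i adj_gram i i.
Proof.
have E : adj_gram *m diag_mx (\row_i x i) *m adj_gram =
    \det laplacian *: adj_gram.
  rewrite {1 2}/adj_gram -!mulmxA (mulmxA B^T) (mulmxA (B^T *m _)).
  rewrite -/laplacian (mulmxA laplacian) mul_mx_adj mul_scalar_mx.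
  by rewrite -!scalemxAr /adj_gram mulmxA.
move: adj_gram adj_gram_sym E => a aC E.
apply/matrixP => i j; rewrite [RHS]mxE [X in _ * X]mxE.
transitivity ((\det laplacian *: a) i i); last by rewrite mxE.
rewrite -E !mxE; apply: eq_bigr => k _; rewrite mul_mx_diag !mxE.
by rewrite [a k i]aC expr2 mulrAC.
Qed.

Lemma adj_gram_diag_weights :
  (\col_i adj_gram i i)^T *m (\col_j x j) = (r%:R * \det laplacian)%:M.
Proof.
apply/matrixP => i j; rewrite !ord1 [RHS]mxE eqxx mulr1n.
transitivity (\tr (adj_gram *m diag_mx (\row_i x i))).
  rewrite mxE; apply: eq_bigr => k _.
  by rewrite mul_mx_diag !mxE.
rewrite /adj_gram -mulmxA -mulmxA mxtrace_mulC -!mulmxA [B^T *m _]mulmxA.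
by rewrite -/laplacian mul_adj_mx mxtrace_scalar mulr_natl.
Qed.

Section Derivative.
Variables (d : {additive A -> A}) (i : 'I_n).
Hypothesis dM : forall a b, d (a * b) = d a * b + a * d b.
Hypothesis dx : forall j, d (x j) = (j == i)%:R.
Hypothesis dB : map_mx d B = 0.

Lemma derivation_laplacian :
  map_mx d laplacian = B^T *m delta_mx i i *m B.
Proof.
rewrite /laplacian !derivation_mulmx // dB mulmx0 addr0 -map_trmx dB trmx0.
rewrite mul0mx add0r; congr (_ *m _ *m _); apply/matrixP => k l.
rewrite !mxE raddfMn /= dx; case: (k =P i) => [->|_] /=; last by rewrite mul0rn.
by rewrite eq_sym.
Qed.

Lemma derivation_det_laplacian : d (\det laplacian) = adj_gram i i.
Proof.
rewrite derivation_det // derivation_laplacian -!mulmxA mxtrace_mulC -!mulmxA.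
rewrite [B *m _]mulmxA -/adj_gram; move: adj_gram => a.
rewrite /mxtrace (bigD1 i) //= big1 ?addr0 => [|k ki]; rewrite mxE.
  rewrite (bigD1 i) //= big1 ?addr0 => [|k ki]; rewrite mxE.
    by rewrite !eqxx mul1r.
  by rewrite (negPf ki) andbF mul0r.
by rewrite big1 // => l _; rewrite mxE (negPf ki) mul0r.
Qed.

(** The second derivatives of [\det laplacian], up to the factor
    [\det laplacian] itself: its first derivatives are the diagonal entries of
    [adj_gram] by [derivation_det_laplacian]. *)
Lemma derivation_adj_gram j :
  \det laplacian * d (adj_gram j j) =
  adj_gram i i * adj_gram j j - adj_gram i j ^+ 2.
Proof.
have : \det laplacian *: map_mx d adj_gram =
    adj_gram i i *: adj_gram - adj_gram *m delta_mx i i *m adj_gram.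
  rewrite {1}/adj_gram !derivation_mulmx // dB mul0mx add0r.
  rewrite -[map_mx d B^T]map_trmx dB trmx0 mulmx0 addr0.
  rewrite scalemxAl scalemxAr derivation_adj // derivation_det_laplacian.
  rewrite mulmxBr mulmxBl -scalemxAr -scalemxAl -/adj_gram.
  by rewrite derivation_laplacian /adj_gram !mulmxA.
move: adj_gram adj_gram_sym => a aC.
move/matrixP/(_ j j); rewrite !mxE => ->; congr (_ - _).
rewrite (bigD1 i) //= [X in _ + X]big1 ?addr0 => [|k ki].
  rewrite mxE (bigD1 i) //= [X in _ + X]big1 ?addr0 => [|k ki].
    by rewrite mxE !eqxx mulr1 aC expr2.
  by rewrite mxE (negPf ki) mulr0.
rewrite mxE big1 ?mul0r // => l _.
by rewrite mxE (negPf ki) andbF mulr0.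
Qed.

End Derivative.
End Laplacian.

Lemma map_laplacian (A A' : comNzRingType) (f : {rmorphism A -> A'}) n r
    (B : 'M[A]_(n, r)) (x : 'I_n -> A) (y : 'I_n -> A') :
  f \o x =1 y -> map_mx f (laplacian B x) = laplacian (map_mx f B) y.
Proof.
move=> xy; rewrite /laplacian !map_mxM map_trmx map_diag_mx.
by congr (_ *m diag_mx _ *m _); apply/rowP => i; rewrite !mxE -xy.
Qed.

Section Hessian.
Variables (R : idomainType) (n r : nat) (B : 'M[R]_(n, r.+1)).

Local Notation x := (fun i : 'I_n => 'X_i : {mpoly R[n]}).
Local Notation B' := (map_mx (@mpolyC n R) B).
Local Notation F := (\det (laplacian B' x)).
Local Notation a := (adj_gram B' x).

Lemma hessian_det_laplacian :
  F *: hessian F =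
  (\col_i a i i) *m (\col_i a i i)^T - \matrix_(i, j) a i j ^+ 2.
Proof.
have dB i : map_mx (mderiv i) B' = 0.
  by apply/matrixP => j k; rewrite !mxE mderivC.
have dx i j : mderiv i (x j) = (j == i)%:R.
  rewrite mderivX mnmE; case: eqP => [->|_]; last by rewrite scale0r.
  rewrite scale1r (_ : (_ - _)%MM = 0%MM) ?mpolyX0 //.
  by apply/mnmP => k; rewrite mnmBE mnm0E subnn.
apply/matrixP => i j; rewrite [LHS]mxE [X in _ * X]mxE.
rewrite (derivation_det_laplacian (mderivM _) (dx j) (dB j)).
rewrite (derivation_adj_gram (mderivM _) (dx i) (dB i)).
by move: a => a; rewrite !mxE big_ord1 !mxE.
Qed.

Lemma det_hessian_det_laplacian : F != 0 ->
  F ^+ n * \det (hessian F) =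
  (-1) ^+ n * (1 - r.+1%:R) * \det (\matrix_(i, j) a i j ^+ 2).
Proof.
move=> F0; rewrite -detZ hessian_det_laplacian -opprB -scaleN1r detZ -mulrA.
congr (_ * _); apply: (mulfI F0).
rewrite (det_rank1_update (adj_gram_squares_weights _ _)
           (adj_gram_diag_weights _ _)).
by rewrite mulrA mulrBr mulr1 [F * _]mulrC.
Qed.

End Hessian.

(** * Symmetric squares of matrices *)

Lemma lup_decomposition (K : fieldType) n (G : 'M[K]_n) :
  exists s : 'S_n, exists L, exists U,
    [/\ perm_mx s *m G = L *m U, forall i j : 'I_n, (i < j)%N -> L i j = 0
      & forall i j : 'I_n, (j < i)%N -> U i j = 0].
Proof.
case: n G => [|n] G.
  by exists 1%g, 0, 0; split=> [||[]]; rewrite ?thinmx0 //; case.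
have := cormen_lup_correct G; have := cormen_lup_perm G.
have := cormen_lup_lower G; have := cormen_lup_upper G.
case: (cormen_lup G) => [[P L] U] /= upU loL /existsP[s /eqP ->] GE.
exists s, L, U; split=> // i j lt_ij.
by rewrite loL ?(ltnW lt_ij) // -val_eqE /= ltn_eqF.
Qed.

Section SymmetricSquare.
(** The pairs [k <= l], which label the basis of the symmetric square, are
    enumerated by ['I_N] through an arbitrary bijection [pr]; for the complete
    graph it is the given labelling of the edges. *)
Variables (r N : nat) (pr : 'I_N -> 'I_r * 'I_r).
Hypothesis pr_inj : injective pr.
Hypothesis pr_im :
  forall p : 'I_r * 'I_r, (p.1 <= p.2)%N <-> exists i, pr i = p.

Local Notation p1 i := (pr i).1.
Local Notation p2 i := (pr i).2.

(** The iterated [op] of [f] over the orbit of the pair [(k, l)] under exchange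
    of its components; it turns sums and products over unordered pairs into
    sums and products over all pairs, see [big_orbits]. *)
Definition orbit_op (T : Type) (op : T -> T -> T) (f : 'I_r -> 'I_r -> T) k l :=
  if k == l then f k l else op (f k l) (f l k).

Lemma pr_le i : (p1 i <= p2 i)%N.
Proof. by apply/pr_im; exists i. Qed.

Lemma big_orbits (T : Type) (idx : T) (op : Monoid.com_law idx)
    (f : 'I_r -> 'I_r -> T) :
  \big[op/idx]_i orbit_op op f (p1 i) (p2 i) =
  \big[op/idx]_k \big[op/idx]_l f k l.
Proof.
rewrite pair_bigA /=.
have -> : \big[op/idx]_i orbit_op op f (p1 i) (p2 i) =
    \big[op/idx]_(p : 'I_r * 'I_r | (p.1 <= p.2)%N) orbit_op op f p.1 p.2.
  have := big_imset (aop := op) (fun p => orbit_op op f p.1 p.2)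
            (in2W pr_inj : {in 'I_N &, injective pr}).
  rewrite big_mkcond [RHS]big_mkcond /= => <-; rewrite [RHS]big_mkcond.
  rewrite big_mkcond /=; apply: eq_bigr => p _.
  case: (boolP (p.1 <= p.2)%N) => [/pr_im[i <-]|pN].
    by rewrite imset_f.
  case: imsetP => // -[i _ pE]; case/negP: pN; apply/pr_im; exists i.
  by rewrite pE.
rewrite [RHS](bigID (fun p : 'I_r * 'I_r => p.1 <= p.2)%N) /=.
rewrite [X in op _ X](reindex_inj (h := fun p => (p.2, p.1))) /=; last first.
  by case=> a b [c e] /= [-> ->].
rewrite [X in op _ X](eq_bigl (fun p : 'I_r * 'I_r => p.1 < p.2)%N); last first.
  by move=> p; rewrite /= -ltnNge.
rewrite (bigID (fun p : 'I_r * 'I_r => p.1 == p.2)) /=.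
rewrite [X in _ = op X _](bigID (fun p : 'I_r * 'I_r => p.1 == p.2)) /=.
have ltE (p : 'I_r * 'I_r) : (p.1 <= p.2)%N && (p.1 != p.2) = (p.1 < p.2)%N.
  by rewrite ltn_neqAle andbC.
rewrite !(eq_bigl _ _ ltE) -Monoid.mulmA; congr (op _ _).
  by apply: eq_bigr => p /andP[_ pE]; rewrite /orbit_op pE.
apply: etrans (big_split _ _ _ _ _); apply: eq_bigr => p lt_p.
rewrite /orbit_op.
by have /negPf-> : p.1 != p.2 by case/andP: (etrans (ltE p) lt_p).
Qed.

Section Ring.
Variable R : comNzRingType.
Implicit Types G H : 'M[R]_r.

(** The symmetric square of [G], acting on quadratic forms: row [i] lists the
    coefficients of the product of the linear forms given by the rows [p1 i] and
    [p2 i] of [G]. *)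
Definition sym2 G : 'M[R]_N :=
  \matrix_(i, j)
    orbit_op +%R (fun k l => G (p1 i) k * G (p2 i) l) (p1 j) (p2 j).

(** The squared norms of the symmetric matrices E_kk and E_kl + E_lk. *)
Definition sym2_weight : 'rV[R]_N := \row_i (if p1 i == p2 i then 1 else 2%:R).

Lemma sum_orbitsMr (f g : 'I_r -> 'I_r -> R) :
    (forall k l, g k l = g l k) ->
  \sum_i orbit_op +%R f (p1 i) (p2 i) * g (p1 i) (p2 i) =
  \sum_k \sum_l f k l * g k l.
Proof.
move=> gC; rewrite -big_orbits; apply: eq_bigr => i _; rewrite /orbit_op.
by case: ifP => //= _; rewrite mulrDl [g (p2 i) _]gC.
Qed.

Lemma sym2M G H : sym2 (G *m H) = sym2 G *m sym2 H.
Proof.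
apply/matrixP => i j; rewrite [RHS]mxE.
pose g a b := orbit_op +%R (fun k l => H a k * H b l) (p1 j) (p2 j).
under eq_bigr => k _ do rewrite 2!mxE -/(g _ _).
rewrite sum_orbitsMr => [|a b]; last first.
  rewrite /g /orbit_op; case: eqP => [->|_]; first exact: mulrC.
  by rewrite addrC [H b _ * _]mulrC [H b _ * _]mulrC.
have E k l : (G *m H) (p1 i) k * (G *m H) (p2 i) l
   = \sum_a \sum_b G (p1 i) a * G (p2 i) b * (H a k * H b l).
  rewrite !mxE mulr_suml; apply: eq_bigr => a _.
  by rewrite mulr_sumr; apply: eq_bigr => b _; rewrite mulrACA.
rewrite mxE /g /orbit_op; case: eqP => [pj|_]; first by rewrite E.
rewrite !E -big_split; apply: eq_bigr => a _.
by rewrite -big_split; apply: eq_bigr => b _; rewrite mulrDr.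
Qed.

Lemma sym2_1 : sym2 1%:M = 1%:M.
Proof.
apply/matrixP => i j; rewrite !mxE /orbit_op !mxE.
have le_i := pr_le i; have le_j := pr_le j.
have -> : (i == j) = (p1 i == p1 j) && (p2 i == p2 j).
  by rewrite -(inj_eq pr_inj) -pair_eqE.
case: eqP => [pj|nj].
  by rewrite -natrM mulnb pj.
rewrite -!natrM !mulnb [X in _ + X](_ : _ = 0) ?addr0 //.
case: eqP => // p12; case: eqP => // p21; case: nj; apply: val_inj.
by apply/eqP; rewrite eqn_leq le_j -p21 -p12.
Qed.

(** For [G] triangular in the order given by [v], the symmetric square is
    triangular for the sum of [v] over the pair.  Both lower and upper
    triangular matrices are covered, with [v i = i] and [v i = r - i]. *)
Lemma det_sym2_triangular G (v : 'I_r -> nat) : injective v ->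
    (forall i j, (v i < v j)%N -> G i j = 0) ->
  \det (sym2 G) = \det G ^+ r.+1.
Proof.
move=> v_inj trG; rewrite (det_graded_triangular (A := G) (w := v)); last first.
  move=> i j; apply: contraNT; rewrite negb_or -leqNgt => /andP[ij le_v].
  by rewrite trG // ltn_neqAle le_v andbT (inj_eq v_inj).
rewrite (det_graded_triangular (w := fun i => v (p1 i) + v (p2 i))%N).
  (* The product of G k k * G l l over k <= l, spread over all pairs (k, l). *)
  pose f k l := if k == l then G k k ^+ 2 else G k k.
  rewrite -prodrXl (eq_bigr (fun k => \prod_l f k l)); last first.
    move=> k _; rewrite (bigD1 k) //= /f eqxx.
    rewrite (eq_bigr (fun => G k k)); last first.
      by move=> l; rewrite eq_sym => /negPf->.
    rewrite prodr_const cardC1 card_ord -exprD; congr (_ ^+ _).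
    by case: r k => [[]|].
  rewrite -big_orbits; apply: eq_bigr => i _; rewrite mxE /orbit_op /f.
  case: eqP => [->|pN]; first by rewrite expr2.
  rewrite eq_sym; case: eqP => [/esym //|_]; rewrite -[RHS]addr0.
  congr (_ + _); have : v (p1 i) != v (p2 i) by apply/eqP => /v_inj.
  by rewrite neq_ltn => /orP[] /trG ->; rewrite ?mul0r ?mulr0.
move=> i j; rewrite mxE -(inj_eq pr_inj) -pair_eqE /= => Gij.
have le_i := pr_le i; have le_j := pr_le j.
have /orP[/andP[k1 k2]|/andP[k1 k2]] :
    (v (p1 j) <= v (p1 i))%N && (v (p2 j) <= v (p2 i))%N
    || (v (p2 j) <= v (p1 i))%N && (v (p1 j) <= v (p2 i))%N.
- apply: contraNT Gij; rewrite negb_or !negb_and -!ltnNge => /andP[h1 h2].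
  have E1 : G (p1 i) (p1 j) * G (p2 i) (p2 j) = 0.
    by case/orP: h1 => /trG ->; rewrite ?mul0r ?mulr0.
  have E2 : G (p1 i) (p2 j) * G (p2 i) (p1 j) = 0.
    by case/orP: h2 => /trG ->; rewrite ?mul0r ?mulr0.
  by rewrite /orbit_op E1 E2 addr0; case: ifP.
- by rewrite -!(inj_eq v_inj); lia.
(* In the crossed case equal weights force p1 j = p2 i and p2 j = p1 i; both
   pairs being ordered, all four indices agree. *)
case: ltnP => [|ge_w]; rewrite ?orbT // orbF.
have /v_inj E1 : v (p2 j) = v (p1 i) by lia.
have /v_inj E2 : v (p1 j) = v (p2 i) by lia.
by rewrite -!val_eqE /= -E1 -E2; rewrite E1 E2 in le_j *; lia.
Qed.

(** The square of (b_i G b_j^T) is the value at the pair of rank one matrices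
    b_i^T b_i and b_j^T b_j of the form (S, T) |-> tr (S G T G^T); [W] expresses
    these matrices in the basis E_kk, E_kl + E_lk. *)
Lemma sym2_quadratic (B : 'M[R]_(N, r)) G :
    let W := \matrix_(i, j) (B i (p1 j) * B i (p2 j)) in
  \matrix_(i, j) ((B *m G *m B^T) i j) ^+ 2 =
  W *m diag_mx sym2_weight *m sym2 G *m W^T.
Proof.
move=> W; apply/matrixP => i j.
have -> : W *m diag_mx sym2_weight =
    \matrix_(i, j) orbit_op +%R (fun k l => B i k * B i l) (p1 j) (p2 j).
  rewrite mul_mx_diag; apply/matrixP => a b; rewrite !mxE /orbit_op.
  by case: eqP => _; ring.
rewrite -[in RHS]mulmxA.
pose g k l := (\sum_a G k a * B j a) * (\sum_b G l b * B j b).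
have -> : sym2 G *m W^T = \matrix_(a, b)
   ((\sum_k G (p1 a) k * B b k) * (\sum_l G (p2 a) l * B b l)).
  apply/matrixP => a b; rewrite !mxE.
  under eq_bigr => k _ do rewrite !mxE.
  rewrite (sum_orbitsMr (fun k l => G (p1 a) k * G (p2 a) l)
             (g := fun k l => B b k * B b l)) => [|k l]; last exact: mulrC.
  rewrite mulr_suml; apply: eq_bigr => k _; rewrite mulr_sumr.
  by apply: eq_bigr => l _; rewrite mulrACA.
rewrite [RHS]mxE.
under [RHS]eq_bigr => k _ do rewrite 2!mxE -/(g _ _).
rewrite sum_orbitsMr => [|k l]; last exact: mulrC.
have E : (B *m G *m B^T) i j = \sum_k B i k * (\sum_a G k a * B j a).
  rewrite -mulmxA mxE; apply: eq_bigr => k _; rewrite mxE; congr (_ * _).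
  by apply: eq_bigr => a _; rewrite mxE.
rewrite mxE E expr2 mulr_suml; apply: eq_bigr => k _; rewrite mulr_sumr.
by apply: eq_bigr => l _; rewrite mulrACA.
Qed.

(** A transposition is an involution, so the determinant of its symmetric
    square has square 1.  Squaring spares the computation of the sign. *)
Lemma det_sym2_perm_sqr (s : 'S_r) : \det (sym2 (perm_mx s)) ^+ 2 = 1.
Proof.
have [ts -> _] := prod_tpermP s.
elim: ts => [|t ts IHts].
  by rewrite big_nil perm_mx1 sym2_1 det1 expr1n.
rewrite big_cons perm_mxM sym2M det_mulmx exprMn IHts mulr1.
by rewrite expr2 -det_mulmx -sym2M -perm_mxM tperm2 perm_mx1 sym2_1 det1.
Qed.

End Ring.

Lemma map_sym2 (R R' : comNzRingType) (f : {rmorphism R -> R'}) (G : 'M[R]_r) :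
  map_mx f (sym2 G) = sym2 (map_mx f G).
Proof.
apply/matrixP => i j; rewrite !mxE /orbit_op !mxE.
by case: eqP => _; rewrite ?rmorphD !rmorphM.
Qed.

Lemma det_sym2_sqr (K : fieldType) (G : 'M[K]_r) :
  \det (sym2 G) ^+ 2 = (\det G ^+ r.+1) ^+ 2.
Proof.
have [s [L [U [GE trL trU]]]] := lup_decomposition G.
have detL : \det (sym2 L) = \det L ^+ r.+1.
  by apply: (det_sym2_triangular (v := val)) trL; apply: val_inj.
have detU : \det (sym2 U) = \det U ^+ r.+1.
  apply: (det_sym2_triangular (v := fun i => r - i)%N) => [i j ij|i j lt_ij].
    by apply: val_inj => /=; have := ltn_ord i; have := ltn_ord j; lia.
  by apply: trU; lia.
have := congr1 (fun A => \det (sym2 A) ^+ 2) GE.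
rewrite !sym2M !det_mulmx exprMn det_sym2_perm_sqr mul1r => ->.
rewrite detL detU -exprMn -det_mulmx -GE det_mulmx det_perm !exprMn.
by rewrite [X in X * _]exprAC sqrr_sign expr1n mul1r.
Qed.

(** [det_sym2_sqr], applied over the fraction field, yields the equality up to
    sign.  The sign is constant along the polynomial path from the identity to
    [G], because polynomials over a domain form a domain, and it is 1 at the
    identity. *)
Lemma det_sym2 (R : idomainType) (G : 'M[R]_r) :
  \det (sym2 G) = \det G ^+ r.+1.
Proof.
have sqrE (R' : idomainType) (H : 'M[R']_r) :
    \det (sym2 H) ^+ 2 = (\det H ^+ r.+1) ^+ 2.
  apply/eqP; rewrite -tofrac_eq !rmorphXn /= -!det_map_mx map_sym2.
  by rewrite det_sym2_sqr.
pose path_G : 'M[{poly R}]_r := 1%:M + 'X *: map_mx polyC (G - 1%:M).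
have eval_G c : map_mx (horner_eval c) path_G = 1%:M + c *: (G - 1%:M).
  apply/matrixP => i j; rewrite !mxE /horner_eval !hornerE /=.
  by case: eqP; rewrite ?hornerE.
have evalE c : (\det (sym2 path_G)).[c] = \det (sym2 (1%:M + c *: (G - 1%:M)))
   /\ (\det path_G ^+ r.+1).[c] = \det (1%:M + c *: (G - 1%:M)) ^+ r.+1.
  by rewrite -!/(horner_eval c _) rmorphXn /= -!det_map_mx map_sym2 eval_G.
have [at1 at1'] := evalE 1; have [at0 at0'] := evalE 0.
rewrite !scale1r !scale0r addr0 addrC subrK in at1 at1' at0 at0'.
have /eqP := sqrE _ path_G; rewrite eqf_sqr => /orP[] /eqP E.
  by rewrite -at1 -at1' E.
have := at0; rewrite E hornerN at0' sym2_1 !det1 expr1n => sign1.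
by rewrite -at1 -at1' E hornerN -mulN1r sign1 mul1r.
Qed.

(** The [r * r] pairs are counted by their orbits under exchange, of size one or
    two. *)
Lemma card_off_diagonal : (N + \sum_i (p1 i != p2 i) = r * r)%N.
Proof.
have := big_orbits addn (fun _ _ => 1%N).
rewrite !sum_nat_const !card_ord muln1 => <-.
have {1}-> : N = (\sum_(i < N) 1)%N by rewrite sum_nat_const card_ord muln1.
by rewrite -big_split; apply: eq_bigr => i _; rewrite /orbit_op; case: eqP.
Qed.

Lemma det_sym2_weight (R : comNzRingType) :
  \det (diag_mx (sym2_weight R)) = 2%:R ^+ (r * r - N).
Proof.
rewrite -card_off_diagonal addKn det_diag -(prodrXr 2%:R).
by apply: eq_bigr => i _; rewrite mxE; case: eqP.
Qed.

Section CompleteIncidence.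
Variable R : idomainType.

(** Row [i] is the incidence vector, restricted to the vertices other than the
    root, of the edge of the complete graph that corresponds to the pair
    [pr i]: the edge from the root to [k] for the pair [(k, k)] and the edge
    from [k] to [l] for [k < l], see [incidence_complete]. *)
Definition complete_incidence : 'M[R]_(N, r) :=
  \matrix_(i, k) ((k == p2 i)%:R - ((k == p1 i) && (p1 i != p2 i))%:R).

(** The rank one matrix of an edge of the star is E_kk, and that of an edge
    [k < l] is E_kk + E_ll - (E_kl + E_lk): a unitriangular change of basis up
    to signs, once the edges of the star come first. *)
Lemma det_complete_incidence_squares :
  \det (\matrix_(i, j)
    (complete_incidence i (p1 j) * complete_incidence i (p2 j))) ^+ 2 = 1.
Proof.
rewrite (det_graded_triangular (w := fun i => p1 i != p2 i)).
  rewrite -prodrXl big1 // => i _; rewrite !mxE !eqxx /=.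
  case: eqP => [->|/eqP p12]; first by rewrite eqxx /= !subr0 mulr1 expr1n.
  by rewrite eq_sym (negPf p12) /= sub0r subr0 mulr1 sqrrN expr1n.
have nz i k : complete_incidence i k != 0 -> k = p1 i \/ k = p2 i.
  rewrite mxE; case: (k =P p2 i) => [|_]; first by right.
  by case: (k =P p1 i) => [|_]; [left | rewrite subrr eqxx].
move=> i j; rewrite mxE -(inj_eq pr_inj) -pair_eqE /= => B0.
have le_i := pr_le i; have le_j := pr_le j.
have /nz : complete_incidence i (p1 j) != 0.
  by apply: contraNneq B0 => ->; rewrite mul0r.
have /nz : complete_incidence i (p2 j) != 0.
  by apply: contraNneq B0 => ->; rewrite mulr0.
rewrite -!val_eqE /=.
move=> [] /(congr1 val) /= E2 [] /(congr1 val) /= E1; rewrite E1 E2 in le_j *.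
all: by do ?[case: (_ =P _) => ? //=]; lia.
Qed.

Lemma det_gram_squares (G : 'M[R]_r) :
  \det (\matrix_(i, j)
    ((complete_incidence *m G *m complete_incidence^T) i j) ^+ 2) =
  2%:R ^+ (r * r - N) * \det G ^+ r.+1.
Proof.
rewrite sym2_quadratic !det_mulmx det_tr mulrC !mulrA -expr2.
by rewrite det_complete_incidence_squares mul1r det_sym2_weight det_sym2.
Qed.

End CompleteIncidence.

End SymmetricSquare.

(** * The matrix-tree theorem *)

(** The column of the root [ord0] is left out. *)
Definition incidence (A : comNzRingType) n r (tl hd : 'I_n -> 'I_r.+1) :
    'M[A]_(n, r) :=
  \matrix_(i, k) ((lift ord0 k == hd i)%:R - (lift ord0 k == tl i)%:R).

Lemma set2_inj (T : finType) (u v a b : T) : a != b ->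
  [set u; v] = [set a; b] -> u = a /\ v = b \/ u = b /\ v = a.
Proof.
move=> nab E; have := set21 a b; have := set22 a b; rewrite -E !inE.
case/orP=> /eqP bE; case/orP=> /eqP aE; rewrite aE bE ?eqxx // in nab *.
  by right.
by left.
Qed.

Section RootedMaps.
Variables (T : finType) (root : T) (step : T -> T).

(** A strictly decreasing rank is a convenient certificate that iterating [step]
    leads to [root]: it serves as the weight for triangularity, for acyclicity
    and for inductions. *)
Definition descent (d : T -> nat) :=
  forall v, v != root -> (d (step v) < d v)%N.

Lemma descent_connect d v : descent d -> fconnect step v root.
Proof.
move=> dd; move: {2}(d v) (leqnn (d v)) => m; elim: m v => [|m IHm] v le_m.
  case: (eqVneq v root) => [-> //|/dd].
  by move/leq_trans/(_ le_m).
case: (eqVneq v root) => [-> //|/dd lt_v].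
apply: connect_trans (fconnect1 step v) (IHm _ _).
by rewrite -ltnS (leq_trans lt_v).
Qed.

Lemma connect_descent : (forall v, fconnect step v root) -> exists d, descent d.
Proof.
move=> to_root.
have reach v : exists n, iter n step v == root.
  by exists (findex step v root); apply/eqP/iter_findex.
exists (fun v => ex_minn (reach v)) => v v_root.
case: ex_minnP => m1 _ min1; case: ex_minnP => -[|m2] it2 _.
  by rewrite it2 in v_root.
by rewrite ltnS; apply: min1; rewrite -iterSr.
Qed.

End RootedMaps.

Section MatrixTree.
Variables (r n : nat) (e : rel 'I_r.+1).
Hypotheses (e_sym : ssrbool.symmetric e) (e_irr : irreflexive e).
Local Notation G := (SGraph e_sym e_irr).
Variable lab : edge_labelling G n.
Variables tl hd : 'I_n -> 'I_r.+1.
Hypothesis labE : forall i, lab i = [set tl i; hd i].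

Implicit Type f : {ffun 'I_r -> 'I_n}.

Lemma tl_neq_hd i : tl i != hd i.
Proof.
have : lab i \in edges G by rewrite -(label_edge_im lab) imset_f.
case/imsetP => -[x y]; rewrite inE /= => exy xyE.
have nxy : x != y by apply: contraTneq exy => ->; rewrite e_irr.
have : #|lab i| = 2 by rewrite xyE cards2 nxy.
by rewrite labE cards2; case: eqP.
Qed.

Lemma hd_neq_tl i : hd i != tl i.
Proof. by rewrite eq_sym tl_neq_hd. Qed.

Definition incident f := [forall k, lift ord0 k \in lab (f k)].

Definition other_end i v := if v == hd i then tl i else hd i.

Definition parent f v :=
  if unlift ord0 v is Some k then other_end (f k) v else ord0.

Definition arborescence f :=
  incident f && [forall v, fconnect (parent f) v ord0].

Lemma parent_lift f k : parent f (lift ord0 k) = other_end (f k) (lift ord0 k).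
Proof. by rewrite /parent liftK. Qed.

Lemma other_endE i v : v \in lab i -> lab i = [set v; other_end i v].
Proof.
rewrite labE !inE /other_end.
case: (v =P hd i) => [->|_]; first by rewrite setUC.
by rewrite orbF => /eqP->.
Qed.

Lemma incident_lab f k : incident f ->
  lab (f k) = [set lift ord0 k; parent f (lift ord0 k)].
Proof. by move/forallP/(_ k)/other_endE; rewrite parent_lift. Qed.

Lemma neq_root (v : 'I_r.+1) : v != ord0 -> exists k, v = lift ord0 k.
Proof. by rewrite eq_sym => /unlift_some[k -> _]; exists k. Qed.

Section Determinant.
Variables (A : comNzRingType) (x : 'I_n -> A).
Local Notation B := (incidence A tl hd).

(** The choice of orientation drops out, since it changes the sign of both
    factors. *)
Lemma incident_row f k l : incident f ->
  B (f k) k * B (f k) l =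
  (k == l)%:R - (lift ord0 l == parent f (lift ord0 k))%:R.
Proof.
move/forallP/(_ k); rewrite labE !inE parent_lift /other_end !mxE => kP.
have th := tl_neq_hd (f k); have ht := hd_neq_tl (f k).
rewrite -[k == l](inj_eq (@lift_inj _ ord0)).
case: (eqVneq (lift ord0 k) (hd (f k))) kP => /= [E|_].
  by rewrite E (negPf ht) subr0 mul1r !(eq_sym (lift ord0 l : 'I_r.+1)).
rewrite orbF => /eqP->.
by rewrite eqxx !(eq_sym (lift ord0 l : 'I_r.+1)) /=; ring.
Qed.

(** The matrix is the identity minus the matrix of the map [parent f].  With a
    rank that decreases along [parent f] it is unitriangular; otherwise the
    vertices that never reach the root are closed under [parent f] in both
    directions, and their indicator vector lies in the kernel. *)
Lemma det_incident f :
  \det (\matrix_(k, l) (B (f k) k * B (f k) l)) = (arborescence f)%:R.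
Proof.
rewrite /arborescence; case: (boolP (incident f)) => [inc|]; last first.
  rewrite negb_forall => /existsP[k]; rewrite labE !inE negb_or => /andP[kt kh].
  rewrite (expand_det_row _ k) big1 // => l _.
  by rewrite 2!mxE (negPf kt) (negPf kh) subrr !mul0r.
case: forallP => /= [/connect_descent[d dd]|not_rooted].
  rewrite (det_graded_triangular (w := fun k => d (lift ord0 k))).
    rewrite big1 // => k _; rewrite mxE incident_row // eqxx.
    case: eqP => [E|_]; last by rewrite subr0.
    by have := dd (lift ord0 k) isT; rewrite -E ltnn.
  move=> k l; rewrite mxE incident_row //; case: (k =P l) => //= _.
  case: (lift ord0 l =P _) => [-> _|_]; last by rewrite subr0 eqxx.
  exact: dd.
have [k0 k0P] : exists k, ~~ fconnect (parent f) (lift ord0 k) ord0.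
  apply/existsP; rewrite -negb_forall; apply/forallP => allk; apply: not_rooted.
  move=> v; case: (eqVneq v ord0) => [->|/neq_root[k ->]]; last exact: allk.
  exact: connect0.
pose v : 'cV[A]_r :=
  \col_k (~~ fconnect (parent f) (lift ord0 k) ord0)%:R.
apply: (det_kernel (v := v) (k := k0)); last by rewrite mxE k0P.
apply/matrixP => k j; rewrite !mxE.
have stepE : fconnect (parent f) (lift ord0 k) ord0 =
    fconnect (parent f) (parent f (lift ord0 k)) ord0.
  apply/idP/idP; last exact: connect_trans (fconnect1 _ _).
  case/connectP => -[|w p] /=; first by move=> _ /eqP.
  by case/andP=> /eqP -> pP E; apply/connectP; exists p.
under eq_bigr => l _ do rewrite mxE incident_row // [v _ _]mxE mulrBl.
rewrite sumrB (bigD1 k) //= eqxx mul1r big1 ?addr0 => [|l]; last first.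
  by rewrite eq_sym => /negPf->; rewrite mul0r.
rewrite stepE; case: (eqVneq (parent f (lift ord0 k)) ord0) => [->|].
  by rewrite connect0 big1 ?subr0 // => l _; rewrite mul0r.
case/neq_root => m ->; rewrite (bigD1 m) //= eqxx mul1r big1 ?addr0 ?subrr //.
by move=> l; rewrite (inj_eq (@lift_inj _ _)) => /negPf->; rewrite mul0r.
Qed.

(** Row [k] of the Laplacian is the sum over the edges [i] of
    [x i * B i k] times row [i] of [B]; multilinearity in the rows expands the
    determinant over all choices of one edge per row. *)
Lemma det_laplacian_arborescences :
  \det (laplacian B x) = \sum_(f | arborescence f) \prod_k x (f k).
Proof.
rewrite big_mkcond /=.
transitivity (\sum_(f : {ffun 'I_r -> 'I_n}) (\prod_k x (f k)) *
                \det (\matrix_(k, l) (B (f k) k * B (f k) l))).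
  rewrite /determinant; under [RHS]eq_bigr => f _ do rewrite mulr_sumr.
  rewrite [RHS]exchange_big; apply: eq_bigr => s _.
  under [X in _ * X]eq_bigr => k _ do rewrite laplacianE.
  rewrite bigA_distr_bigA mulr_sumr; apply: eq_bigr => f _.
  rewrite [RHS]mulrCA -big_split; congr (_ * _); apply: eq_bigr => k _.
  by rewrite [in RHS]mxE.
apply: eq_bigr => f _; rewrite det_incident.
by case: ifP => _; rewrite ?mulr1 ?mulr0.
Qed.

End Determinant.

Definition tree_of f : {set 'I_n} := [set f k | k : 'I_r].

Local Notation edge_set S := [set lab i | i in S].

Lemma mem_edge_set (S : {set 'I_n}) i : (lab i \in edge_set S) = (i \in S).
Proof. by rewrite mem_imset //; apply: label_edge_inj. Qed.

Section Arborescence.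
Variables (f : {ffun 'I_r -> 'I_n}) (d : 'I_r.+1 -> nat).
Hypotheses (inc : incident f) (dd : descent ord0 (parent f) d).

(** Two vertices that chose the same edge would be each other's parent. *)
Lemma arborescence_inj : injective f.
Proof.
move=> k l fkl; apply: (@lift_inj _ ord0); apply/eqP; apply: contraT => nkl.
have := incident_lab k inc; have := incident_lab l inc; rewrite fkl => -> E.
have := set21 (lift ord0 k) (parent f (lift ord0 k)).
rewrite -E !inE (negPf nkl) => /eqP Ek.
have := set21 (lift ord0 l) (parent f (lift ord0 l)).
rewrite E !inE eq_sym (negPf nkl) => /eqP El.
have := @dd (lift ord0 k) isT; have := @dd (lift ord0 l) isT.
by rewrite -Ek -El => /ltnW; rewrite leqNgt => /negP.
Qed.

(** An edge always leads from a vertex to its parent or back, and the parent is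
    the endpoint of smaller rank. *)
Lemma edge_rel_tree_of u v :
  edge_rel (edge_set (tree_of f) : {set {set G}}) u v ->
  (d v <= d u)%N -> v = parent f u.
Proof.
case/imsetP => _ /imsetP[k _ ->]; rewrite (incident_lab k inc) => E le_d.
have nroot : lift ord0 k != ord0 by [].
have lt_k := dd nroot; have ne_k : lift ord0 k != parent f (lift ord0 k).
  by apply: contraTneq lt_k => <-; rewrite ltnn.
case: (set2_inj ne_k E) => -[uE vE]; first by rewrite uE vE.
by rewrite uE vE leqNgt lt_k in le_d.
Qed.

Lemma tree_of_parent u : u != ord0 ->
  edge_rel (edge_set (tree_of f) : {set {set G}}) u (parent f u).
Proof.
case/neq_root => k ->; rewrite /edge_rel -incident_lab //.
by rewrite mem_edge_set imset_f.
Qed.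

Lemma edge_rel_sym (T : {set {set G}}) : ssrbool.symmetric (edge_rel T).
Proof. by move=> u v; rewrite /edge_rel setUC. Qed.

Lemma tree_of_connected :
  spanning_connected (edge_set (tree_of f) : {set {set G}}).
Proof.
have to_root u :
    connect (edge_rel (edge_set (tree_of f) : {set {set G}})) u ord0.
  move: {2}(d u) (leqnn (d u)) => m; elim: m u => [|m IHm] u le_m.
    case: (eqVneq u ord0) => [-> //|/dd].
    by move/leq_trans/(_ le_m).
  case: (eqVneq u ord0) => [-> //|u0].
  apply: connect_trans (connect1 (tree_of_parent u0)) (IHm _ _).
  by rewrite -ltnS (leq_trans (dd u0)).
apply/forallP => u; apply/forallP => v; apply: connect_trans (to_root u) _.
have sym := sym_connect_sym (@edge_rel_sym (edge_set (tree_of f))).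
by rewrite sym; apply: to_root.
Qed.

(** Both neighbours on a cycle of a vertex of maximal rank would have to be its
    parent. *)
Lemma tree_of_acyclic : acyclic (edge_set (tree_of f) : {set {set G}}).
Proof.
apply/acyclicP => c c_gt2 cyc.
have [u0 u0c] : exists u, u \in c.
  by case: c c_gt2 {cyc} => // u; exists u; rewrite mem_head.
case: (arg_maxnP d u0c) => u uc u_max.
case/rot_to: (uc) => i c' cE.
have sz : (2 < size (u :: c'))%N by rewrite -cE size_rot.
have mem_c w : w \in u :: c' -> (d w <= d u)%N.
  by rewrite -cE mem_rot => /u_max.
move: cyc; rewrite -(rot_ucycle i) cE.
case: c' sz mem_c {cE} => [|v [|w c']] // _ mem_c /andP[/= ].
rewrite rcons_path => /andP[uv /andP[_ zu]] /and3P[_ v_c _].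
have vE : v = parent f u.
  by apply: edge_rel_tree_of uv _; apply: mem_c; rewrite !inE eqxx orbT.
have z_c : last w c' \in w :: c' by apply: mem_last.
have zE : last w c' = parent f u.
  apply: edge_rel_tree_of; first by rewrite edge_rel_sym; case/andP: zu.
  by apply: mem_c; rewrite !(in_cons _ _ (last _ _)) -in_cons z_c !orbT.
by rewrite vE -zE z_c in v_c.
Qed.

Lemma tree_of_spanning_tree :
  spanning_tree (edge_set (tree_of f) : {set {set G}}).
Proof.
rewrite /spanning_tree tree_of_connected tree_of_acyclic !andbT.
by apply/subsetP => _ /imsetP[i _ ->]; rewrite -(label_edge_im lab) imset_f.
Qed.

Lemma prod_tree_of (A : comNzRingType) (x : 'I_n -> A) :
  \prod_(i in tree_of f) x i = \prod_k x (f k).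
Proof.
by rewrite big_imset //= => k l _ _; apply: arborescence_inj.
Qed.

End Arborescence.

Lemma arborescenceP f :
  reflect (incident f /\ exists d, descent ord0 (parent f) d) (arborescence f).
Proof.
apply: (iffP andP) => -[inc] => [/forallP|[d dd]].
  by split=> //; apply: connect_descent.
by split=> //; apply/forallP => v; apply: descent_connect dd.
Qed.

(** By induction on the rank of [k] for [f].  If [g] assigned the edge [f k] to
    another vertex [l], then [l] would be the parent of [k], so [f] and [g]
    agree at [l] and [f] takes the value [f k] at [l] too. *)
Lemma tree_of_inj f g : arborescence f -> arborescence g ->
  tree_of f = tree_of g -> f = g.
Proof.
case/arborescenceP=> incf [d dd] /arborescenceP[incg _] fg.
suff fgE m k : (d (lift ord0 k) <= m)%N -> f k = g k.
  by apply/ffunP => k; apply: fgE (leqnn _).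
elim: m k => [|m IHm] k le_m.
  by have /leq_trans/(_ le_m) := @dd (lift ord0 k) isT.
have : f k \in tree_of g by rewrite -fg imset_f.
case/imsetP => l _ fkE; case: (eqVneq k l) => [kl|nkl]; first by rewrite fkE kl.
have := @dd (lift ord0 k) isT; have := incident_lab k incf.
have := set21 (lift ord0 l) (parent g (lift ord0 l)).
rewrite -incident_lab // -fkE => + kE; rewrite kE !inE.
rewrite (inj_eq (@lift_inj _ _)) eq_sym (negPf nkl) => /eqP <- lt_d.
have := IHm l; rewrite -ltnS (leq_trans lt_d) // -fkE => /(_ isT).
by move/(arborescence_inj incf dd) => lk; rewrite lk eqxx in nkl.
Qed.

(** The rank is the distance to the root. *)
Lemma connected_descent (S : {set 'I_n}) :
    spanning_connected (edge_set S : {set {set G}}) ->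
  exists d : 'I_r.+1 -> nat, forall v, v != ord0 ->
    exists2 i, i \in S & exists2 w, lab i = [set v; w] & (d w < d v)%N.
Proof.
move=> conn; set E := edge_rel (edge_set S : {set {set G}}).
have reach v :
    exists m, [exists p : m.-tuple G, path E v p && (last v p == ord0)].
  have /connectP[p pP pE] := forallP (forallP conn v) ord0.
  by exists (size p); apply/existsP; exists (in_tuple p); rewrite pP -pE eqxx.
exists (fun v => ex_minn (reach v)) => v v0.
case: (ex_minnP (reach v)) => m /existsP[p /andP[pP pE]] _.
case: m p pP pE => [|m] p; first by rewrite tuple0 /= (negPf v0).
case/tupleP: p => w p /= /andP[/imsetP[i iS vw] pP] pE; exists i => //.
exists w; first by rewrite vw.
case: ex_minnP => m' _; apply; apply/existsP; exists p.
by rewrite pP.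
Qed.

(** An edge of [S] outside [S'] would close a cycle with the path of [S']
    that joins its endpoints. *)
Lemma acyclic_connected_max (S S' : {set 'I_n}) :
    S' \subset S -> acyclic (edge_set S : {set {set G}}) ->
    spanning_connected (edge_set S' : {set {set G}}) ->
  S' = S.
Proof.
move=> sub /acyclicP acyc conn; apply/eqP; rewrite eqEsubset sub /=.
apply/subsetP => i iS; apply: contraT => iS'.
have /connectP[p0 p0P] := forallP (forallP conn (tl i)) (hd i).
case/shortenP: p0P => p pP p_uniq _ {p0} hdE.
have := acyc (tl i :: p); case.
  case: p pP hdE {p_uniq} => [|w [|//]] /=.
    by move=> _ E; have := tl_neq_hd i; rewrite E eqxx.
  move=> + E; rewrite -E andbT /edge_rel -labE mem_edge_set.
  by rewrite (negPf iS').
rewrite /ucycle; apply/andP; split=> //=; rewrite rcons_path -hdE.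
apply/andP; split; last by rewrite /edge_rel setUC -labE mem_edge_set.
apply: sub_path pP => u v; rewrite /edge_rel => /imsetP[j jS' ->].
by rewrite mem_edge_set (subsetP sub).
Qed.

(** Every vertex chooses the first edge of a shortest path to the root; the
    chosen edges already connect the graph, so they exhaust the tree. *)
Lemma spanning_tree_arborescence (S : {set 'I_n}) :
    spanning_tree (edge_set S : {set {set G}}) ->
  exists2 f : {ffun 'I_r -> 'I_n}, arborescence f & tree_of f = S.
Proof.
case/and3P=> _ conn acyc; have [d dP] := connected_descent conn.
have /fin_all_exists[g gP] k : exists i, [/\ i \in S, lift ord0 k \in lab i
    & (d (other_end i (lift ord0 k)) < d (lift ord0 k))%N].
  have [i iS [w labi lt_w]] := dP (lift ord0 k) isT.
  have k_i : lift ord0 k \in lab i by rewrite labi set21.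
  exists i; split=> //; have := other_endE k_i; rewrite labi => E.
  have nkw : lift ord0 k != w by apply: contraTneq lt_w => <-; rewrite ltnn.
  by case: (set2_inj nkw (esym E)) => -[E1 ->]; rewrite // E1 eqxx in nkw.
pose f := [ffun k => g k].
have inc : incident f by apply/forallP => k; rewrite ffunE; case: (gP k).
have dd : descent ord0 (parent f) d.
  by move=> _ /neq_root[k ->]; rewrite parent_lift ffunE; case: (gP k).
exists f; first by apply/arborescenceP; split=> //; exists d.
apply: acyclic_connected_max acyc (tree_of_connected inc dd).
by apply/subsetP => _ /imsetP[k _ ->]; rewrite ffunE; case: (gP k).
Qed.

Theorem matrix_tree (A : comNzRingType) (x : 'I_n -> A) :
  \det (laplacian (incidence A tl hd) x) =
  \sum_(S : {set 'I_n} | spanning_tree (edge_set S : {set {set G}}))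
    \prod_(i in S) x i.
Proof.
rewrite det_laplacian_arborescences.
transitivity
  (\sum_(S in [set tree_of f | f in arborescence]) \prod_(i in S) x i).
  rewrite big_imset /=; last by move=> f g; apply: tree_of_inj.
  apply: eq_bigr => f /arborescenceP[inc [d dd]].
  by rewrite (prod_tree_of inc dd).
apply: eq_bigl => S; apply/imsetP/idP => [[f /arborescenceP[inc [d dd]] ->]|].
  exact: tree_of_spanning_tree inc dd.
by case/spanning_tree_arborescence => f fA <-; exists f.
Qed.

Corollary kirchhoff_det (R : comNzRingType) :
  kirchhoff R lab =
  \det (laplacian (incidence {mpoly R[n]} tl hd) (fun i => 'X_i)).
Proof. by rewrite matrix_tree. Qed.

End MatrixTree.

(** * Complete graphs *)

Section CompleteEdges.
Variable r : nat.
Implicit Types p q : 'I_r * 'I_r.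

(** The correspondence between the pairs [k <= l] and the edges of the complete
    graph on ['I_r.+1]: [(k, k)] is the edge from the root to [k], and [(k, l)]
    with [k < l] is the edge from [k] to [l]. *)
Definition pair_tail p : 'I_r.+1 :=
  if p.1 == p.2 then ord0 else lift ord0 p.1.

Definition pair_head p : 'I_r.+1 := lift ord0 p.2.

Definition pair_edge p := [set pair_tail p; pair_head p].

Lemma pair_tail_head p : (p.1 <= p.2)%N -> (pair_tail p < pair_head p)%N.
Proof.
move=> le_p; rewrite /pair_tail /pair_head -val_eqE /=.
by case: eqP => [|ne_p]; rewrite /= /bump /=; lia.
Qed.

Lemma pair_edge_inj p q : (p.1 <= p.2)%N -> (q.1 <= q.2)%N ->
  pair_edge p = pair_edge q -> p = q.
Proof.
move=> le_p le_q; have tp := pair_tail_head le_p.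
have tq := pair_tail_head le_q.
have nq : pair_tail q != pair_head q by rewrite -val_eqE ltn_eqF.
case/(set2_inj nq) => -[tE hE]; last by rewrite tE hE ltnNge ltnW in tp.
have e2 := lift_inj hE; case: p q le_p le_q tE e2 {tp tq nq hE} => a b [c e] /=.
rewrite /pair_tail /= => _ _ + be; rewrite be.
case: (eqVneq a e) => [-> | _]; case: (eqVneq c e) => [-> // | _] //.
by move/lift_inj ->.
Qed.

Lemma pair_edge_complete (E : {set 'I_r.+1}) : #|E| == 2%N ->
  exists p, (p.1 <= p.2)%N /\ E = pair_edge p.
Proof.
case/cards2P=> x [y]; wlog lt_xy : x y / (x < y)%N => [IH|] [nxy EE].
  have [lt_xy|] := ltnP x y; first by apply: (IH x y).
  rewrite leq_eqVlt val_eqE eq_sym (negPf nxy) => /= lt_yx.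
  by apply: (IH y x) => //; rewrite setUC eq_sym.
rewrite {}EE.
have [|q yE] := @neq_root _ y.
  by rewrite -val_eqE /= -lt0n (leq_ltn_trans _ lt_xy).
case: (eqVneq x ord0) => [->|/neq_root[p xE]].
  by exists (q, q); rewrite /pair_edge /pair_tail /pair_head /= eqxx yE.
exists (p, q); rewrite xE yE /= !/bump /= in lt_xy *; split; first by lia.
rewrite /pair_edge /pair_tail /pair_head /= ifN //.
by rewrite -val_eqE /=; lia.
Qed.

Lemma complete_edge_pairs n (lab : edge_labelling (complete_graph r.+1) n) :
  exists pr : 'I_n -> 'I_r * 'I_r,
    [/\ injective pr,
        forall p, (p.1 <= p.2)%N <-> exists i, pr i = p
      & forall i, lab i = pair_edge (pr i)].
Proof.
have /fin_all_exists[pr prP] i :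
    exists p, (p.1 <= p.2)%N /\ lab i = pair_edge p.
  apply: pair_edge_complete; have : lab i \in edges (complete_graph r.+1).
    by rewrite -(label_edge_im lab) imset_f.
  by rewrite edges_completeE inE.
exists pr; split=> [i j ij|p|i]; last by have [] := prP i.
  apply: (@label_edge_inj _ _ lab).
  by have [_ ->] := prP i; have [_ ->] := prP j; rewrite ij.
split=> [le_p|[i <-]]; last by have [] := prP i.
have : pair_edge p \in edges (complete_graph r.+1).
  rewrite edges_completeE inE cards2.
  by rewrite neq_ltn pair_tail_head.
rewrite -(label_edge_im lab) => /imsetP[i _ labi]; exists i.
have [le_i iE] := prP i; apply: pair_edge_inj => //.
by rewrite labi.
Qed.

Lemma incidence_complete (A : idomainType) n (pr : 'I_n -> 'I_r * 'I_r) :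
  incidence A (pair_tail \o pr) (pair_head \o pr) = complete_incidence pr A.
Proof.
apply/matrixP => i k; rewrite !mxE /= /pair_tail /pair_head.
rewrite (inj_eq (@lift_inj _ _)).
by case: ifP => _; rewrite ?andbF ?andbT // (inj_eq (@lift_inj _ _)).
Qed.

End CompleteEdges.

(** Giving weight 1 to the edges at the root and 0 to the others exhibits a
    point where the Kirchhoff polynomial does not vanish. *)
Lemma laplacian_star r N (pr : 'I_N -> 'I_r * 'I_r) (R : idomainType) :
    injective pr ->
    (forall p : 'I_r * 'I_r, (p.1 <= p.2)%N <-> exists i, pr i = p) ->
  laplacian (complete_incidence pr R)
    (fun i => ((pr i).1 == (pr i).2)%:R) = 1%:M.
Proof.
move=> pr_inj pr_im; apply/matrixP => k l; rewrite laplacianE [RHS]mxE.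
pose f a b : R := ((a == b) && (k == b) && (l == b))%:R.
transitivity (\sum_i orbit_op +%R f (pr i).1 (pr i).2).
  apply: eq_bigr => i _; rewrite !mxE /orbit_op /f.
  case: (eqVneq (pr i).1 (pr i).2) => [->|ne] /=; last first.
    by rewrite mul0r addr0.
  by rewrite !andbF !subr0 mul1r -natrM mulnb.
rewrite big_orbits // (bigD1 k) //= [X in _ + X]big1 ?addr0 => [|a ak].
  rewrite (bigD1 k) //= big1 ?addr0 => [|b bk].
    by rewrite /f !eqxx eq_sym.
  by rewrite /f eq_sym (negPf bk).
rewrite big1 // => b _; rewrite /f.
case: (eqVneq a b) => //= ab; case: (eqVneq k b) => //= kb.
by rewrite ab kb eqxx in ak.
Qed.

Lemma bin2_split r : (2 <= r)%N ->
  [/\ r * r - 'C(r.+1, 2) = 'C(r.+1, 2) - r,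
      (r - 1) * r.+1 = 'C(r.+1, 2) + ('C(r.+1, 2) - r - 1)
    & 0 < 'C(r.+1, 2)]%N.
Proof.
case: r => [|[|s]] // _; have := mul_bin_diag s.+3 1; rewrite bin1 /=.
by move: 'C(_, _) => C E; split; nia.
Qed.

Theorem theorem4p4 (R : numDomainType) (r : nat) (hr : (2 <= r)%N)
    (lab : edge_labelling (complete_graph r.+1) 'C(r.+1, 2)) :
  let N := 'C(r.+1, 2) in
  let F : {mpoly R[N]} := kirchhoff R lab in
  let c : {mpoly R[N]} := (2 ^ (N - r) * (r - 1))%N%:R in
  \det (hessian F) = (-1) ^+ (N - 1) * c * F ^+ (N - r - 1).
Proof.
case: r hr lab => [//|r] hr lab N F c.
have [pr [pr_inj pr_im labE]] := complete_edge_pairs lab.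
pose B := complete_incidence pr R; pose x i : {mpoly R[N]} := 'X_i.
pose B' := map_mx (@mpolyC N R) B.
have B'E : B' = complete_incidence pr {mpoly R[N]}.
  by apply/matrixP => i k; rewrite !mxE rmorphB !rmorph_nat.
have FE : F = \det (laplacian B' x).
  rewrite B'E -incidence_complete.
  exact: (@kirchhoff_det r.+1 N (@complete_adj _) (@complete_adj_sym _)
            (@complete_adj_irr _) lab (@pair_tail _ \o pr)
            (@pair_head _ \o pr) labE R).
have F0 : F != 0.
  have : F.@[fun i => ((pr i).1 == (pr i).2)%:R] = 1.
    set v := fun i => _.
    have xv : meval v \o x =1 v by move=> i; rewrite /= mevalXU.
    rewrite FE -det_map_mx (map_laplacian _ xv).
    apply: etrans (det1 R r.+1); congr (\det _).
    rewrite -(laplacian_star R pr_inj pr_im) -/B.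
    by congr laplacian; apply/matrixP => i k; rewrite 2!mxE /= mevalC.
  by apply: contra_eq_neq => ->; rewrite raddf0 eq_sym oner_eq0.
have [E1 E2 N0] := bin2_split hr; rewrite -/N in E1 E2 N0.
have detH : F ^+ N * \det (hessian F) = (-1) ^+ N * (1 - r.+1%:R) *
    \det (\matrix_(i, j) adj_gram B' x i j ^+ 2).
  by rewrite FE; apply: det_hessian_det_laplacian; rewrite -FE.
have detQ : \det (\matrix_(i, j) adj_gram B' x i j ^+ 2) =
    2%:R ^+ (N - r.+1) * F ^+ (N + (N - r.+1 - 1)).
  rewrite -E2 -E1 exprM subn1 /= {1}FE -det_adjugate -?FE // B'E.
  exact: det_gram_squares.
apply: (mulfI (expf_neq0 N F0)); rewrite {}detH {}detQ exprD /c.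
have signE m : (0 < m)%N -> (-1) ^+ m = - (-1) ^+ (m - 1) :> {mpoly R[N]}.
  by case: m => // m _; rewrite subn1 exprS mulN1r.
rewrite [(-1) ^+ N]signE //.
rewrite natrM natrX [(r.+1 - 1)%N]subn1 /= -natr1.
move: (F ^+ N) (F ^+ _) ((-1) ^+ _) (2%:R ^+ _) (r%:R) => a b s t k; ring.
Qed.
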